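(* Let $\mathcal{M}=(X,\leq,R,V)$ and $\mathcal{M}'=(X',\leq',R',V')$ be strictly condensed $\mathsf{Int}_{\Box}$-models such that $\leq$, $\leq'$, $R$ and $R'$ are image-compact. Then for all $x\in X$ and $x'\in X'$, $x$ and $x'$ are $\mathsf{Int}_{\Box}$-bisimilar if and only if they satisfy exactly the same $\mathsf{Int}_{\Box}$-formulae.
   Context: For relations $Z,Z'$ write $x(Z\circ Z')y$ iff there is $u$ with $xZu$ and $uZ'y$; $Z[x]=\{y\mid xZy\}$. $\mathsf{Int}_\Box$ is intuitionistic propositional logic ($\top,\bot,p,\wedge,\vee,\to$ over a set $\mathrm{Prop}$) extended with a unary $\Box$. An $\mathsf{Int}_{\Box}$-model is $(X,\leq,R,V)$ with $\leq$ a preorder, $R\subseteq X\times X$ satisfying $({\leq}\circ R)\subseteq(R\circ{\leq})$, and $V$ mapping each variable to an upset of $(X,\leq)$; it is strictly condensed if $({\leq}\circ R\circ{\leq})\subseteq R$. Truth: $x\Vdash p$ iff $x\in V(p)$; $\wedge,\vee,\top,\bot$ as usual; $x\Vdash\phi\to\psi$ iff for all $y\geq x$, $y\Vdash\phi$ implies $y\Vdash\psi$; $x\Vdash\Box\phi$ iff $y\Vdash\phi$ for all $y$ with $xRy$. For upsets $a,b$: $a\Rightarrow b=\{x\mid\forall y\geq x(y\in a\Rightarrow y\in b)\}$, $\boxminus_R a=\{x\mid R[x]\subseteq a\}$. A relation $Z\in\{\leq,R\}$ of the model is image-compact if there is a collection $A$ of upsets containing $\emptyset,X$ and all $V(p)$,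 closed under finite unions, finite intersections, $\Rightarrow$ and $\boxminus_R$, such that $Z[x]$ is compact for every $x$ in the topology generated by the subbase $A\cup\{X\setminus a\mid a\in A\}$. An $\mathsf{Int}_\Box$-bisimulation is $B\subseteq X\times X'$ such that for all $(x,x')\in B$: $x\in V(p)$ iff $x'\in V'(p)$ for all $p$; if $x\leq y$ there is $y'$ with $x'\leq'y'$, $yBy'$; if $x'\leq'y'$ there is $y$ with $x\leq y$, $yBy'$; if $xRy$ there is $y'$ with $x'R'y'$, $yBy'$; if $x'R'y'$ there is $y$ with $xRy$, $yBy'$. States are bisimilar if some bisimulation contains the pair. *)

(* Defs.v *)
From HB Require Import structures.
From mathcomp Require Import all_boot.
From mathcomp Require Import boolp classical_sets topology.

Set Implicit Arguments.
Unset Strict Implicit.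
Unset Printing Implicit Defensive.

Local Open Scope classical_set_scope.

Inductive formula (P : Type) : Type :=
| fTop
| fBot
| fVar of P
| fAnd of formula P & formula P
| fOr of formula P & formula P
| fImp of formula P & formula P
| fBox of formula P.

Arguments fTop {P}.
Arguments fBot {P}.

(* Relations are curried, so that the image Z[x] is the set [Z x]. *)
Definition rel_comp (X : Type) (Z Z' : X -> set X) : X -> set X :=
  fun x y => exists u, Z x u /\ Z' u y.

Definition rel_incl (X : Type) (Z Z' : X -> set X) : Prop :=
  forall x, Z x `<=` Z' x.

Definition upset (X : Type) (le : X -> set X) (a : set X) : Prop :=
  forall x y, le x y -> a x -> a y.

Record model (P : Type) : Type := Model {
  state :> Type;
  mle : state -> set state;
  macc : state -> set state;
  mval : P -> set state;
  mle_refl : forall x, mle x x;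
  mle_trans : forall x y z, mle x y -> mle y z -> mle x z;
  mle_macc : rel_incl (rel_comp mle macc) (rel_comp macc mle);
  mval_upset : forall p, upset mle (mval p)
}.

Arguments mle {P} M : rename.
Arguments macc {P} M : rename.
Arguments mval {P} M : rename.

Definition strictly_condensed (P : Type) (M : model P) : Prop :=
  rel_incl (rel_comp (mle M) (rel_comp (macc M) (mle M))) (macc M).

Fixpoint forces (P : Type) (M : model P) (x : M) (phi : formula P) : Prop :=
  match phi with
  | fTop => True
  | fBot => False
  | fVar p => mval M p x
  | fAnd f g => forces x f /\ forces x g
  | fOr f g => forces x f \/ forces x g
  | fImp f g => forall y, mle M x y -> forces y f -> forces y g
  | fBox f => forall y, macc M x y -> forces y f
  end.

Definition heyting_imp (X : Type) (le : X -> set X) (a b : set X) : set X :=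
  [set x | forall y, le x y -> a y -> b y].

Definition boxminus (X : Type) (R : X -> set X) (a : set X) : set X :=
  [set x | R x `<=` a].

(* Closure under finite unions and intersections is split into the nullary
   cases (set0 and setT) and the binary ones. *)
Record admissible (P : Type) (M : model P) (A : set (set M)) : Prop := {
  admissible_upset : forall a, A a -> upset (mle M) a;
  admissible_set0 : A set0;
  admissible_setT : A setT;
  admissible_val : forall p, A (mval M p);
  admissible_setU : forall a b, A a -> A b -> A (a `|` b);
  admissible_setI : forall a b, A a -> A b -> A (a `&` b);
  admissible_imp : forall a b, A a -> A b -> A (heyting_imp (mle M) a b);
  admissible_box : forall a, A a -> A (boxminus (macc M) a)
}.

(* [subbase_space S] is X with the topology generated by the subbase S. The
   classical choice structure is only there because topologicalType extends
   choiceType. *)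
Definition subbase_space (X : Type) (S : set (set X)) : Type := X.
HB.instance Definition _ (X : Type) (S : set (set X)) :=
  gen_eqMixin (subbase_space S).
HB.instance Definition _ (X : Type) (S : set (set X)) :=
  gen_choiceMixin (subbase_space S).
HB.instance Definition _ (X : Type) (S : set (set X)) :=
  isSubBaseTopological.Build (subbase_space S) S id.

Definition signed_family (X : Type) (A : set (set X)) : set (set X) :=
  A `|` [set ~` a | a in A].

Definition image_compact (P : Type) (M : model P) (Z : M -> set M) : Prop :=
  exists A : set (set M), admissible A /\
    forall x, compact (Z x : set (subbase_space (signed_family A))).

Record bisimulation (P : Type) (M M' : model P) (B : M -> M' -> Prop) : Prop := {
  bisim_val : forall x x', B x x' -> forall p, mval M p x <-> mval M' p x';
  bisim_le_forth : forall x x', B x x' ->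
    forall y, mle M x y -> exists y', mle M' x' y' /\ B y y';
  bisim_le_back : forall x x', B x x' ->
    forall y', mle M' x' y' -> exists y, mle M x y /\ B y y';
  bisim_acc_forth : forall x x', B x x' ->
    forall y, macc M x y -> exists y', macc M' x' y' /\ B y y';
  bisim_acc_back : forall x x', B x x' ->
    forall y', macc M' x' y' -> exists y, macc M x y /\ B y y'
}.

Definition bisimilar (P : Type) (M M' : model P) (x : M) (x' : M') : Prop :=
  exists B : M -> M' -> Prop, bisimulation B /\ B x x'.

(* Main.v *)
(* Logical equivalence is itself a bisimulation. Given x equivalent to x' and
   a successor y of x, the sets of successors of x' that force phi but not
   psi, where y forces phi but not psi, form a filter base, and any cluster
   point of it among the successors of x' is equivalent to y. Non-emptiness
   for the order uses phi -> psi at x'; for R it uses box (phi -> psi), which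
   works because strict condensation makes R[x'] an upset. *)
From mathcomp Require Import all_boot.
From mathcomp Require Import boolp classical_sets filter topology.
Require Import Defs.

Set Implicit Arguments.
Unset Strict Implicit.
Unset Printing Implicit Defensive.

Local Open Scope classical_set_scope.

Definition logically_equivalent (P : Type) (M M' : model P) (x : M) (x' : M') :
  Prop := forall phi : formula P, forces x phi <-> forces x' phi.

Lemma logically_equivalent_sym (P : Type) (M M' : model P) (x : M) (x' : M') :
  logically_equivalent x x' -> logically_equivalent x' x.
Proof. by move=> e phi; split=> /e. Qed.

(** Induction on the formula, for all related pairs at once. For implication and box, the back
    clauses carry truth from [x] to [x'], the forth clauses from [x'] to [x]. *)
Lemma bisimulation_forces (P : Type) (M M' : model P) (B : M -> M' -> Prop) :
  bisimulation B -> forall x x', B x x' -> logically_equivalent x x'.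
Proof.
move=> bB x x' Bxx' phi; elim: phi x x' Bxx' =>
  [||p|f IHf g IHg|f IHf g IHg|f IHf g IHg|f IHf] x x' Bxx' //=.
- exact: (bisim_val bB).
- by split=> -[/(IHf _ _ Bxx') ? /(IHg _ _ Bxx') ?].
- by split=> -[/(IHf _ _ Bxx') ?|/(IHg _ _ Bxx') ?]; [left|right|left|right].
- split=> H.
  + move=> y' /(bisim_le_back bB Bxx')[y [xy Byy']] /(IHf _ _ Byy') fy.
    exact/(IHg _ _ Byy')/H.
  + move=> y /(bisim_le_forth bB Bxx')[y' [xy Byy']] /(IHf _ _ Byy') fy.
    exact/(IHg _ _ Byy')/H.
- split=> H.
  + move=> y' /(bisim_acc_back bB Bxx')[y [xy Byy']].
    exact/(IHf _ _ Byy')/H.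
  + move=> y /(bisim_acc_forth bB Bxx')[y' [xy Byy']].
    exact/(IHf _ _ Byy')/H.
Qed.

(** Each closure condition matches one connective. Truth sets are therefore clopen, whichever family
    witnesses compactness. *)
Lemma admissible_forces (P : Type) (M : model P) (A : set (set M))
  (phi : formula P) : admissible A -> A [set x | forces x phi].
Proof.
move=> aA; elim: phi => [||p|f IHf g IHg|f IHf g IHg|f IHf g IHg|f IHf] /=.
- exact: (admissible_setT aA).
- exact: (admissible_set0 aA).
- exact: (admissible_val aA).
- exact: (admissible_setI aA IHf IHg).
- exact: (admissible_setU aA IHf IHg).
- exact: (admissible_imp aA IHf IHg).
- exact: (admissible_box aA IHf).
Qed.

Lemma subbase_open (X : Type) (S : set (set X)) (a : set X) :
  S a -> open (a : set (subbase_space S)).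
Proof.
move=> Sa; exists [set a]; last by rewrite bigcup_set1.
by move=> _ ->; apply: finI_from1.
Qed.

(** Conjunctions and disjunctions merge finitely many requirements into one pair [f], [g], so the
    last hypothesis is finite satisfiability in [K] of everything [y] forces and refutes. *)
Lemma compact_logically_equivalent (P : Type) (M M' : model P) (y : M)
  (A : set (set M')) (K : set M') :
  admissible A -> compact (K : set (subbase_space (signed_family A))) ->
  (forall f g, forces y f -> ~ forces y g ->
     exists z, [/\ K z, forces z f & ~ forces z g]) ->
  exists2 z, K z & logically_equivalent y z.
Proof.
move=> aA cK sat.
pose T := subbase_space (signed_family A).
pose F : set (set T) := [set S | exists f g, [/\ forces y f, ~ forces y g &
   forall z : M', K z -> forces z f -> ~ forces z g -> S z]].
have FF : ProperFilter F.
  apply: Build_ProperFilter_ex.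
    by move=> S [f [g [yf yg FS]]]; have [z []] := sat _ _ yf yg; exists z; exact: FS.
  split.
  (* This pair imposes no condition beyond membership in [K]. *)
  - by exists fTop, fBot; split=> // -[].
  - move=> S S' [f [g [yf yg FS]]] [f' [g' [yf' yg' FS']]].
    exists (fAnd f f'), (fOr g g'); split=> //=; first by case.
    by move=> z Kz [? ?] /not_orP[? ?]; split; [exact: FS|exact: FS'].
  - move=> S S' SS' [f [g [yf yg FS]]]; exists f, g; split=> // z Kz zf zg.
    exact/SS'/FS.
have FK : F K by exists fTop, fBot; split=> // -[].
have [z [Kz clz]] := cK F FF FK.
exists z => // phi.
have nbhs_signed (a : set T) : signed_family A a -> a z -> nbhs (z : T) a.
  by move=> Sa az; apply: open_nbhs_nbhs; split=> //; exact: subbase_open.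
have Aphi := admissible_forces phi aA.
(* If [y] and [z] disagreed on [phi], the truth set of [phi] and its complement would be, in some
   order, a member of [F] and a neighbourhood of [z], yet disjoint. *)
split=> H; apply: contrapT => nH.
- have FS : F [set w : M' | forces w phi] by exists phi, fBot; split=> // -[].
  have [|w []] := clz _ _ FS (nbhs_signed (~` [set w : M' | forces w phi]) _ nH) => //.
  by right; exists [set w : M' | forces w phi].
- have FS : F (~` [set w : M' | forces w phi]) by exists fTop, phi; split.
  by have [|w []] := clz _ _ FS (nbhs_signed [set w : M' | forces w phi] _ H) => //; left.
Qed.

Lemma logically_equivalent_le (P : Type) (M M' : model P) (x : M) (x' : M') :
  image_compact (mle M') -> logically_equivalent x x' ->
  forall y, mle M x y -> exists2 y', mle M' x' y' & logically_equivalent y y'.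
Proof.
move=> [A [aA cA]] e y xy; apply: (compact_logically_equivalent aA (cA x')).
move=> f g yf yg; apply: contrapT => no; apply: yg.
have /e : forces x' (fImp f g); last exact.
by move=> z xz zf; apply: contrapT => zg; apply: no; exists z.
Qed.

Lemma logically_equivalent_acc (P : Type) (M M' : model P) (x : M) (x' : M') :
  strictly_condensed M' -> image_compact (macc M') ->
  logically_equivalent x x' ->
  forall y, macc M x y -> exists2 y', macc M' x' y' & logically_equivalent y y'.
Proof.
move=> sc [A [aA cA]] e y xy; apply: (compact_logically_equivalent aA (cA x')).
move=> f g yf yg; apply: contrapT => no; apply: yg.
(* Transferred to [x], the boxed implication holds at [y] and is applied there by reflexivity,
   contradicting the choice of [f] and [g]. *)
have /e/(_ y xy y (mle_refl y) yf) : forces x' (fBox (fImp f g)); last exact.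
move=> w xw z wz zf; apply: contrapT => zg; apply: no; exists z; split=> //.
by apply: sc; exists x'; split; [exact: mle_refl|exists w].
Qed.

Theorem theorem5p10 (P : Type) (M M' : model P)
  (scM : strictly_condensed M) (scM' : strictly_condensed M')
  (le_cpt : image_compact (mle M)) (le_cpt' : image_compact (mle M'))
  (acc_cpt : image_compact (macc M)) (acc_cpt' : image_compact (macc M'))
  (x : M) (x' : M') :
  bisimilar x x' <-> (forall phi : formula P, forces x phi <-> forces x' phi).
Proof.
split=> [[B [bB Bxx']]|e]; first exact: bisimulation_forces bB _ _ Bxx'.
exists (@logically_equivalent P M M'); split=> //.
split=> {e}x {}x' e.
- by move=> p; exact: (e (fVar p)).
- by move=> y /(logically_equivalent_le le_cpt' e)[y']; exists y'.
(* The back clauses are the forth clauses with the two models exchanged. *)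
- move=> y' /(logically_equivalent_le le_cpt (logically_equivalent_sym e))[y].
  by move=> xy /logically_equivalent_sym; exists y.
- by move=> y /(logically_equivalent_acc scM' acc_cpt' e)[y']; exists y'.
- move=> y'.
  move=> /(logically_equivalent_acc scM acc_cpt (logically_equivalent_sym e))[y].
  by move=> xy /logically_equivalent_sym; exists y.
Qed.
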